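(* Let $k\in\{1,\dots,d\}$, let $Q_0=\max\bigl(1,(n+2)\,C'_{d+1-k}\,|\alpha|^{-1}\bigr)$, and let $$c_1=(n+1)^{-1}|\alpha|,\quad c_2=(n+2)^{-1}|\alpha|,\quad c_3=(\det\Lambda)^2\, d!\,|\alpha|,\quad c_4=2c_3 .$$ If $Q\ge Q_0$, then $$c_1\,\Psi'_{d+1-k}(c_2Q)\le \Psi_k(Q)\le c_3\,\Psi'_{d+1-k}(c_4Q).$$
   Context: Let $n\ge 2$ and $\alpha=(\alpha_0,\dots,\alpha_{n-1})\in\mathbb{R}^n\setminus\{0\}$. For $x=(x_0,\dots,x_{n-1})\in\mathbb{R}^n$ put $|x|=\max_{0\le i\le n-1}|x_i|$, and let $x\cdot y$ be the standard scalar product. Standing assumption: $|\alpha|=|\alpha_0|$. A vector subspace of $\mathbb{R}^n$ is rational if it has a basis of vectors in $\mathbb{Q}^n$. Let $F$ be the smallest rational subspace of $\mathbb{R}^n$ containing $\alpha$, let $d=\dim F$, and let $\Lambda=\mathbb{Z}^n\cap F$, which is a lattice in $F$. Here $F$ carries the Euclidean structure induced from $\mathbb{R}^n$, and $\det\Lambda$ is the absolute value of the determinant of a $\mathbb{Z}$-basis of $\Lambda$ with respect to an orthonormal basis of $F$. For $k\in\{1,\dots,d\}$ and real $Q\ge1$, $\Psi_k(Q)$ is the infimum of the set of $K>0$ such that there exist $k$ linearly independent vectors $x\in\mathbb{Z}^n\cap F$ with $|x|\le K$ and $|x_0\alpha-\alpha_0x|\le Q^{-1}$ (this set is non-empty).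 For $k\in\{1,\dots,d\}$, $C'_k$ is the least integer $Q\ge1$ for which there exist $k$ linearly independent vectors $x\in\mathbb{Z}^n\cap F$ with $|x|\le Q$. For real $Q\ge C'_k$, $\Psi'_k(Q)$ is the supremum of the set of $K>0$ such that there exist $k$ linearly independent vectors $x\in\mathbb{Z}^n\cap F$ with $|x|\le Q$ and $|x\cdot\alpha|\le K^{-1}$. *)

(* Defs.v *)
From HB Require Import structures.
From mathcomp Require Import all_boot all_order all_algebra.
From mathcomp Require Import all_classical all_reals all_analysis.

Set Implicit Arguments.
Unset Strict Implicit.
Unset Printing Implicit Defensive.

Import Order.TTheory GRing.Theory Num.Theory.
Import numFieldNormedType.Exports.

Local Open Scope classical_set_scope.
Local Open Scope ring_scope.

(* The library norm `|x| on 'rV[R]_n is the maximum norm (mx_normrE), and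
   [free X] is linear independence over R. *)

Definition dot (R : realType) (n : nat) (x y : 'rV[R]_n) : R :=
  \sum_i x 0 i * y 0 i.

Definition rational_vec (R : realType) (n : nat) (x : 'rV[R]_n) : Prop :=
  exists q : 'rV[rat]_n, x = map_mx ratr q.

Definition rational_subspace (R : realType) (n : nat)
    (V : {vspace 'rV[R]_n}) : Prop :=
  exists X : seq 'rV[R]_n,
    basis_of V X /\ (forall x, x \in X -> rational_vec x).

Definition smallest_rational_subspace (R : realType) (n : nat)
    (alpha : 'rV[R]_n) (F : {vspace 'rV[R]_n}) : Prop :=
  [/\ rational_subspace F,
      alpha \in F
    & forall V : {vspace 'rV[R]_n},
        rational_subspace V -> alpha \in V -> (F <= V)%VS].

Definition int_points (R : realType) (n : nat) (F : {vspace 'rV[R]_n})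
    : set 'rV[R]_n :=
  [set x | x \in F /\ exists z : 'rV[int]_n, x = map_mx intr z].

Definition Z_basis (R : realType) (n d : nat) (F : {vspace 'rV[R]_n})
    (B : d.-tuple 'rV[R]_n) : Prop :=
  (forall i : 'I_d, int_points F (tnth B i)) /\
  (forall x, int_points F x ->
     exists! c : 'rV[int]_d, x = \sum_(i < d) tnth B i *~ c 0 i).

Definition orthonormal_basis (R : realType) (n d : nat)
    (F : {vspace 'rV[R]_n}) (E : d.-tuple 'rV[R]_n) : Prop :=
  basis_of F E /\
  (forall i j : 'I_d, dot (tnth E i) (tnth E j) = (i == j)%:R).

(* [coord E j v] is the j-th coordinate of v in the basis E. *)
Definition is_lattice_det (R : realType) (n : nat) (F : {vspace 'rV[R]_n})
    (D : R) : Prop :=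
  exists B E : (\dim F).-tuple 'rV[R]_n,
    [/\ Z_basis F B,
        orthonormal_basis F E
      & D = `|\det (\matrix_(i < \dim F, j < \dim F) coord E j (tnth B i))| ].

Definition indep_int_points (R : realType) (n : nat) (F : {vspace 'rV[R]_n})
    (k : nat) (A : set 'rV[R]_n) : Prop :=
  exists X : k.-tuple 'rV[R]_n,
    free X /\ (forall x, x \in X -> int_points F x /\ A x).

(* The set is non-empty and bounded below by 0 when 1 <= k <= \dim F, so [inf]
   is the genuine infimum. *)
Definition Psi (R : realType) (n : nat) (alpha : 'rV[R]_n) (i0 : 'I_n)
    (F : {vspace 'rV[R]_n}) (k : nat) (Q : R) : R :=
  inf [set K : R | 0 < K /\
    indep_int_points F k
      [set x : 'rV[R]_n | `|x| <= K /\
               `|x 0 i0 *: alpha - alpha 0 i0 *: x| <= Q^-1]].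

Definition is_Cprime (R : realType) (n : nat) (F : {vspace 'rV[R]_n})
    (k : nat) (C : nat) : Prop :=
  [/\ (1 <= C)%N,
      indep_int_points F k [set x : 'rV[R]_n | `|x| <= C%:R]
    & forall C' : nat, (1 <= C')%N ->
        indep_int_points F k [set x : 'rV[R]_n | `|x| <= C'%:R] -> (C <= C')%N].

(* For 1 <= k <= \dim F and Q at least the integer C of [is_Cprime F k C] the
   set is non-empty; it is bounded above because finitely many integer points
   satisfy `|x| <= Q, and an integer point x of F with dot x alpha = 0 is 0
   when F is the smallest rational subspace containing alpha. So [sup] is the
   genuine supremum on this range of Q. *)
Definition Psi' (R : realType) (n : nat) (alpha : 'rV[R]_n)
    (F : {vspace 'rV[R]_n}) (k : nat) (Q : R) : R :=
  sup [set K : R | 0 < K /\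
    indep_int_points F k
      [set x : 'rV[R]_n | `|x| <= Q /\ `|dot x alpha| <= K^-1]].

(* Main.v *)
Require Import Defs.
From HB Require Import structures.
From mathcomp Require Import all_boot all_order all_algebra.
From mathcomp Require Import all_classical all_reals all_analysis.
From mathcomp Require Import perm ring lra zify.

(** Write [D] for the Gram determinant of a Z-basis of the lattice of integer
    points of [F], that is [D = detL ^+ 2]; it is an integer.

    Left inequality.  Take [k] independent points [x] admissible for [Psi] and
    [d + 1 - k] independent points [y] admissible for [Psi'].  Two subspaces of
    a [d]-dimensional Euclidean space whose dimensions add up to more than [d]
    are not orthogonal, so some integer [dot x y] is nonzero, hence of absolute
    value at least 1.  Expanding [alpha_0 (x . y)] as
    [x_0 (alpha . y) - (x_0 alpha - alpha_0 x) . y] bounds [|alpha|] in terms of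
    the two parameters ([primal_dual_product]).

    Right inequality.  Its core is a transference principle between a lattice
    and its dual, used with an ellipsoid elongated in the direction of [alpha],
    so that reduction of quadratic forms can replace volume arguments.  The
    ellipsoid lies in the box that defines [Psi] for the parameter [K]
    ([elong_le1_norm], [elong_le1_close]).  In a suitably reduced basis of the
    lattice, a nondecreasing sequence [e] bounds the form at the basis vectors
    from above, and its inverses bound, up to the factor [d!(d-1)!], the dual
    form at the dual basis vectors ([reduction]).  According to whether the
    [k]-th term of [e] is at most 1 or not, either the first [k] basis vectors
    lie in the ellipsoid, or the last [d + 1 - k] dual basis vectors are short
    ([transference]).  Multiplied by [D], dual vectors become integer points,
    with coordinates in the original basis given by the adjugate of the Gram
    matrix, and the Cauchy--Schwarz inequality for the two forms shows that
    they are admissible for [Psi'] with parameter [K / c3]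
    ([primal_or_dual_points]).  Thus every [K >= 1/2] that is not admissible for
    [Psi] is at most [c3] times the supremum [Psi'], while [Psi] is at least 1.

    The factor needed is [d!], whose square exceeds [d!(d-1)!] by the factor
    [d].  For [d >= 2] this surplus pays for shortening the axis of the
    ellipsoid so as to fit it into the box; for [d = 1] the ellipsoid is a
    segment on the line of [alpha], and no shortening is called for.

    Finiteness of [Psi'] and nonemptiness of the set that defines [Psi] both
    come from the minimality of [F]: a nonzero integer point of [F] is never
    orthogonal to [alpha], and there are finitely many of bounded norm
    ([int_points_dot_bounded_below]). *)

Set Implicit Arguments.
Unset Strict Implicit.
Unset Printing Implicit Defensive.

Import Order.TTheory GRing.Theory Num.Theory.
Import numFieldNormedType.Exports.

Local Open Scope ring_scope.

Section Transference.
Variable R : realType.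

Notation toR := (map_mx (intr : int -> R)).

(** * Positive definite forms *)

Definition qf (d : nat) (G : 'M[R]_d) (x : 'rV[R]_d) : R :=
  (x *m G *m x^T) 0 0.

Definition posdef (d : nat) (G : 'M[R]_d) : Prop :=
  G^T = G /\ forall x, x != 0 -> 0 < qf G x.

Lemma dotE n (x y : 'rV[R]_n) : dot x y = (x *m y^T) 0 0.
Proof. by rewrite /dot mxE; apply: eq_bigr => i _; rewrite mxE. Qed.

Lemma dotC n (x y : 'rV[R]_n) : dot x y = dot y x.
Proof. by apply: eq_bigr => i _; rewrite mulrC. Qed.

Lemma dotBl n (x y z : 'rV[R]_n) : dot (x - y) z = dot x z - dot y z.
Proof. by rewrite !dotE mulmxBl !mxE. Qed.

Lemma dotZl n a (x y : 'rV[R]_n) : dot (a *: x) y = a * dot x y.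
Proof. by rewrite !dotE -scalemxAl !mxE. Qed.

Lemma dot_ge0 n (x : 'rV[R]_n) : 0 <= dot x x.
Proof. by apply: sumr_ge0 => i _; rewrite -expr2 sqr_ge0. Qed.

Lemma dot_eq0 n (x : 'rV[R]_n) : dot x x = 0 -> x = 0.
Proof.
move=> /eqP; rewrite psumr_eq0; last by move=> i _; rewrite -expr2 sqr_ge0.
move=> /allP h; apply/rowP => i; rewrite mxE; apply/eqP.
by rewrite -sqrf_eq0 expr2; apply: h (mem_index_enum i).
Qed.

Lemma dot_gt0 n (x : 'rV[R]_n) : x != 0 -> 0 < dot x x.
Proof.
move=> x0; rewrite lt_def dot_ge0 andbT; apply: contra_neq x0.
exact: dot_eq0.
Qed.

Lemma qf0 d (G : 'M[R]_d) : qf G 0 = 0.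
Proof. by rewrite /qf !mul0mx mxE. Qed.

Lemma posdef_ge0 d (G : 'M[R]_d) x : posdef G -> 0 <= qf G x.
Proof.
move=> [_ Gp]; have [->|/Gp/ltW//] := eqVneq x 0; by rewrite qf0.
Qed.

Lemma qf_mul d m (P : 'M[R]_(m, d)) (G : 'M[R]_d) x :
  qf G (x *m P) = qf (P *m G *m P^T) x.
Proof. by rewrite /qf trmx_mul !mulmxA. Qed.

Lemma qf_delta d (G : 'M[R]_d) i : qf G (delta_mx 0 i) = G i i.
Proof. by rewrite /qf -rowE trmx_delta -colE !mxE. Qed.

Lemma qf_row d m (P : 'M[R]_(m, d)) (G : 'M[R]_d) i :
  qf G (row i P) = (P *m G *m P^T) i i.
Proof. by rewrite rowE qf_mul qf_delta. Qed.

Lemma posdef_unit d (G : 'M[R]_d) : posdef G -> G \in unitmx.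
Proof.
move=> [_ Gp]; rewrite -row_free_unit; apply/row_freeP; exists (invmx G).
apply: mulmxV; rewrite -row_free_unit -kermx_eq0; apply/negPn/negP => K0.
have /rowV0Pn[x /sub_kermxP xG /Gp] := K0.
by rewrite /qf xG mul0mx mxE ltxx.
Qed.

Lemma posdef_congr d (P G : 'M[R]_d) :
  P \in unitmx -> posdef G -> posdef (P *m G *m P^T).
Proof.
move=> Pu [Gs Gp]; split; first by rewrite !trmx_mul trmxK Gs mulmxA.
move=> x x0; rewrite -qf_mul; apply: Gp; apply: contra_neq x0 => xP.
by rewrite -[x](mulmxK Pu) xP mul0mx.
Qed.

Lemma posdef_inv d (G : 'M[R]_d) : posdef G -> posdef (invmx G).
Proof.
move=> Gp; have Gu := posdef_unit Gp; have [Gs _] := Gp.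
have -> : invmx G = invmx G *m G *m (invmx G)^T.
  by rewrite mulVmx // mul1mx trmx_inv Gs.
by apply: posdef_congr => //; rewrite unitmx_inv.
Qed.

Lemma qfB d (G : 'M[R]_d) x y : G^T = G ->
  qf G (x - y) = qf G x - 2 * (x *m G *m y^T) 0 0 + qf G y.
Proof.
move=> Gs; rewrite /qf linearB /= !mulmxBl !mulmxBr.
have -> : y *m G *m x^T = (x *m G *m y^T)^T.
  by rewrite !trmx_mul trmxK Gs mulmxA.
by rewrite !mxE; ring.
Qed.

Lemma qfZ d (G : 'M[R]_d) a x : qf G (a *: x) = a ^+ 2 * qf G x.
Proof. by rewrite /qf linearZ /= -!scalemxAl -scalemxAr !mxE; ring. Qed.

(** Nonnegativity of [qf G] at [x - t *: y *m invmx G], for the value of [t]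
    that minimises it. *)
Lemma dual_cauchy_schwarz d (G : 'M[R]_d) x y : posdef G ->
  (dot x y) ^+ 2 <= qf G x * qf (invmx G) y.
Proof.
move=> Gp; have Gu := posdef_unit Gp; have [Gs _] := Gp.
have Ip := posdef_inv Gp.
have [->|y0] := eqVneq y 0.
  by rewrite qf0 mulr0 dotE trmx0 mulmx0 mxE expr0n.
have p : 0 < qf (invmx G) y by apply: Ip.2.
set t := dot x y; set p' := qf _ y in p *.
have := posdef_ge0 (x - (t / p') *: (y *m invmx G)) Gp.
rewrite (qfB _ _ Gs) qfZ [(_ *: _)^T]linearZ /= -scalemxAr mxE.
have -> : x *m G *m (y *m invmx G)^T = x *m y^T.
  by rewrite trmx_mul trmx_inv Gs -mulmxA (mulmxA G) mulmxV // mul1mx.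
rewrite -dotE -/t.
have -> : qf G (y *m invmx G) = p'.
  by rewrite qf_mul trmx_inv Gs mulVmx // mul1mx.
have -> : qf G x - 2 * (t / p' * t) + (t / p') ^+ 2 * p' = qf G x - t ^+ 2 / p'.
  by field; rewrite gt_eqF.
by rewrite subr_ge0 ler_pdivrMr.
Qed.

(** Each cross term is dominated by the mean of two diagonal ones, because the
    form is nonnegative at [r_i e_i - r_j e_j]. *)
Lemma qf_le_diag d (G : 'M[R]_d) (r : 'rV[R]_d) : posdef G ->
  qf G r <= d%:R * \sum_i (r 0 i) ^+ 2 * G i i.
Proof.
move=> Gp; have [Gs _] := Gp.
have E : qf G r = \sum_i \sum_j r 0 i * r 0 j * G i j.
  rewrite /qf mxE exchange_big /=; apply: eq_bigr => j _.
  by rewrite !mxE mulr_suml; apply: eq_bigr => i _; ring.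
have le i j : r 0 i * r 0 j * G i j <=
    2^-1 * (r 0 i ^+ 2 * G i i + r 0 j ^+ 2 * G j j).
  have := posdef_ge0 (r 0 i *: delta_mx 0 i - r 0 j *: delta_mx 0 j) Gp.
  rewrite (qfB _ _ Gs) !qfZ !qf_delta [(_ *: _)^T]linearZ /= -scalemxAr.
  rewrite -!scalemxAl.
  rewrite -rowE trmx_delta -colE !mxE.
  lra.
rewrite E; apply: (@le_trans _ _ (\sum_i \sum_j
  2^-1 * (r 0 i ^+ 2 * G i i + r 0 j ^+ 2 * G j j))).
  by apply: ler_sum => i _; apply: ler_sum => j _.
pose S := \sum_i r 0 i ^+ 2 * G i i.
rewrite (eq_bigr (fun i => 2^-1 * (d%:R * (r 0 i ^+ 2 * G i i) + S)));
  last first.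
  move=> i _; rewrite -mulr_sumr big_split /= sumr_const card_ord.
  by rewrite -[_ *+ d]mulr_natl.
rewrite -/S -mulr_sumr big_split /= -mulr_sumr sumr_const card_ord -/S.
rewrite -[S *+ d]mulr_natl.
lra.
Qed.

(** * Minimal vectors of a form on integer vectors *)

Lemma bounded_argmin d (P : 'rV[int]_d -> Prop) (f : 'rV[int]_d -> R)
    (N : nat) x0 :
  P x0 -> (forall x, P x -> f x <= f x0 -> forall i, `|x 0 i| <= N%:Z) ->
  exists2 x, P x & forall y, P y -> f x <= f y.
Proof.
move=> Px0 bd.
(* The integers between -N and N are coded by ordinals shifted by N. *)
pose dec (u : {ffun 'I_d -> 'I_(N + N).+1}) : 'rV[int]_d :=
  \row_i ((u i : nat)%:Z - N%:Z).
have decP x : P x -> f x <= f x0 -> exists u, dec u = x.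
  move=> Px /(bd _ Px) xN.
  exists [ffun i => inord (absz (x 0 i + N%:Z))]; apply/rowP => i.
  rewrite mxE ffunE; have := xN i; rewrite ler_norml => /andP[h1 h2].
  have h : 0 <= x 0 i + N%:Z by rewrite -lerBlDr sub0r.
  rewrite inordK; first by rewrite gez0_abs // addrK.
  rewrite ltnS -lez_nat gez0_abs // PoszD; exact: lerD.
have [u0 u0E] := decP _ Px0 (lexx _).
pose p u := `[< P (dec u) >].
have pu0 : p u0 by apply/asboolP; rewrite u0E.
case: (arg_minP (fun u => f (dec u)) pu0) => u /asboolP Pu umin.
exists (dec u) => // y Py; have [le|/ltW le] := leP (f y) (f x0).
  have [v vE] := decP _ Py le; rewrite -vE; apply: umin.
  by apply/asboolP; rewrite vE.
by apply: le_trans le; rewrite -u0E; apply: umin.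
Qed.

Lemma intmx_unit d (U : 'M[int]_d) : U \in unitmx -> toR U \in unitmx.
Proof.
move=> Uu; have : toR U *m toR (invmx U) = 1%:M.
  by rewrite -map_mxM mulmxV // map_mx1.
by case/mulmx1_unit.
Qed.

Lemma intmx_inv d (U : 'M[int]_d) : U \in unitmx ->
  toR (invmx U) = invmx (toR U).
Proof.
move=> Uu; rewrite -[RHS]mul1mx -(@map_mx1 _ _ (intr : int -> R)).
by rewrite -(mulVmx Uu) map_mxM mulmxK // intmx_unit.
Qed.

(** Only finitely many integer vectors have a form value below a given bound:
    the dual Cauchy--Schwarz inequality against the unit vectors controls their
    coordinates. *)
Lemma posdef_argmin d (G : 'M[R]_d) (P : 'rV[int]_d -> Prop) x0 :
  posdef G -> P x0 ->
  exists2 x, P x & forall y, P y -> qf G (toR x) <= qf G (toR y).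
Proof.
move=> Gp Px0.
pose c := qf G (toR x0); pose I := invmx G.
have Ip : posdef I := posdef_inv Gp.
have c0 : 0 <= c := posdef_ge0 _ Gp.
have I0 i : 0 <= I i i by rewrite -qf_delta posdef_ge0.
pose M := \sum_i c * I i i.
have M0 : 0 <= M by apply: sumr_ge0 => i _; rewrite mulr_ge0.
apply: (@bounded_argmin _ P (fun x => qf G (toR x)) (Num.bound M) x0) => //.
move=> x Px le i.
rewrite leNgt; apply/negP => lt.
have : (x 0 i)%:~R ^+ 2 <= M :> R.
  have := dual_cauchy_schwarz (toR x) (delta_mx 0 i) Gp.
  rewrite qf_delta dotE trmx_delta -colE !mxE -/I => h.
  apply: (le_trans h); apply: (@le_trans _ _ (c * I i i)).
    by rewrite ler_wpM2r.
  by rewrite /M (bigD1 i) //= lerDl sumr_ge0 // => j _; rewrite mulr_ge0.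
apply/negP; rewrite -ltNge; apply: (lt_trans (archi_boundP M0)).
rewrite -rmorphXn /= -[X in X < _]/((Posz (Num.bound M))%:~R) ltr_int.
apply: (lt_le_trans lt); rewrite -[x 0 i ^+ 2]real_normK ?num_real //.
by rewrite ler_eXnr // -gtz0_ge1; apply: le_lt_trans lt.
Qed.

(** * Reduction *)

Definition shear d (r : 'cV[R]_d) : 'M[R]_(1 + d) := block_mx 1%:M 0 r 1%:M.

Lemma shearM d (r s : 'cV[R]_d) : shear r *m shear s = shear (r + s).
Proof.
by rewrite /shear mulmx_block !mulmx1 !mul1mx !mulmx0 !mul0mx !addr0 add0r.
Qed.

Lemma shear0 d : shear (0 : 'cV_d) = 1%:M.
Proof. by rewrite /shear -scalar_mx_block. Qed.

Lemma shearKN d (r : 'cV[R]_d) : shear r *m shear (- r) = 1%:M.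
Proof. by rewrite shearM subrr shear0. Qed.

Lemma shearNK d (r : 'cV[R]_d) : shear (- r) *m shear r = 1%:M.
Proof. by rewrite shearM addNr shear0. Qed.

Lemma shear_unit d (r : 'cV[R]_d) : shear r \in unitmx.
Proof. by case/mulmx1_unit: (shearKN r). Qed.

Definition diag_block d (g : R) (H : 'M[R]_d) : 'M[R]_(1 + d) :=
  block_mx g%:M 0 0 H.

Lemma shear_congr d (r : 'cV[R]_d) (g : R) H :
  shear r *m diag_block g H *m (shear r)^T =
  block_mx g%:M (g *: r^T) (g *: r) (H + g *: (r *m r^T)).
Proof.
rewrite /shear /diag_block tr_block_mx !trmx1 trmx0 !mulmx_block.
rewrite !mulmx1 !mul1mx !mulmx0 !mul0mx !addr0 !add0r mul_scalar_mx.
by rewrite mul_mx_scalar -scalemxAl addrC.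
Qed.

(** The inverse of a shear is the opposite shear, so that the diagonal entries
    of the inverse, the first one excepted, are those of [invmx H]. *)
Lemma shear_congr_invmx d (r : 'cV[R]_d) (g : R) H : g != 0 -> H \in unitmx ->
  invmx (shear r *m diag_block g H *m (shear r)^T) =
  block_mx (g^-1%:M + r^T *m invmx H *m r) (- (r^T *m invmx H))
           (- (invmx H *m r)) (invmx H).
Proof.
move=> g0 Hu; set G := _ *m _ *m _; set X := block_mx _ _ _ _.
have XE : X = (shear (- r))^T *m diag_block g^-1 (invmx H) *m shear (- r).
  rewrite /shear /diag_block tr_block_mx !trmx1 trmx0 !mulmx_block.
  rewrite !mulmx1 !mul1mx !mulmx0 !mul0mx !addr0 !add0r [(- r)^T]linearN /=.
  by rewrite !(mulmxN, mulNmx) opprK.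
have E : X *m G = 1%:M.
  rewrite XE /G -!mulmxA (mulmxA (shear (- r)) (shear r)) shearNK mul1mx.
  rewrite (mulmxA (diag_block _ _) (diag_block g H)).
  have -> : diag_block g^-1 (invmx H) *m diag_block g H = 1%:M.
    rewrite /diag_block mulmx_block !mul0mx !mulmx0 !add0r !addr0 mulVmx //.
    by rewrite -scalar_mxM mulVf // -scalar_mx_block.
  by rewrite mul1mx -trmx_mul shearKN trmx1.
have [_ Gu] := mulmx1_unit E.
by rewrite -[LHS]mul1mx -E mulmxK.
Qed.

Lemma schur_complement d (G : 'M[R]_(1 + d)) : posdef G ->
  exists r : 'cV[R]_d, exists g, exists H,
  [/\ G = shear r *m diag_block g H *m (shear r)^T, 0 < g & posdef H].
Proof.
move=> Gp; have [Gs _] := Gp.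
pose g := G 0 0; pose c : 'cV_d := dlsubmx G; pose r := g^-1 *: c.
pose H := drsubmx G - g *: (r *m r^T).
have g0 : 0 < g.
  rewrite /g -qf_delta; apply: Gp.2; apply/eqP => /rowP/(_ 0).
  by rewrite !mxE !eqxx; apply/eqP; rewrite oner_eq0.
have E : G = shear r *m diag_block g H *m (shear r)^T.
  rewrite shear_congr /H subrK /r linearZ /= !scalerA divff ?gt_eqF // !scale1r.
  rewrite -[LHS]submxK; congr block_mx.
    by rewrite [LHS]mx11_scalar !mxE; congr scalar_mx; congr (G _ _);
    apply: val_inj.
  by rewrite -[in LHS]Gs trmx_dlsub.
exists r, g, H; split => //.
have Dp : posdef (diag_block g H).
  have -> : diag_block g H = shear (- r) *m G *m (shear (- r))^T.
    rewrite E !mulmxA shearNK mul1mx -mulmxA -trmx_mul shearNK trmx1 mulmx1 //.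
  by apply: posdef_congr => //; apply: shear_unit.
split.
  have [/(congr1 (@drsubmx _ 1 d 1 d))] := Dp.
  by rewrite -trmx_drsub /diag_block block_mxKdr.
move=> x x0.
have : qf (diag_block g H) (row_mx 0 x) = qf H x.
  rewrite /qf /diag_block tr_row_mx mul_row_block mul_row_col.
  rewrite !mul0mx !mulmx0 !add0r.
  by rewrite trmx0 mulmx0 add0r.
move<-; apply: Dp.2; apply: contra_neq x0 => /(congr1 (@rsubmx _ 1 1 d)).
by rewrite row_mxKr linear0.
Qed.

(** The Gram matrix after the change of basis whose rows are those of [U]. *)
Definition int_congr d (U : 'M[int]_d) (G : 'M[R]_d) : 'M[R]_d :=
  toR U *m G *m (toR U)^T.

Lemma int_congrM d (U V : 'M[int]_d) G :
  int_congr (U *m V) G = int_congr U (int_congr V G).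
Proof. by rewrite /int_congr map_mxM trmx_mul !mulmxA. Qed.

Lemma int_congr_posdef d (U : 'M[int]_d) G :
  U \in unitmx -> posdef G -> posdef (int_congr U G).
Proof. by move=> Uu; apply: posdef_congr; apply: intmx_unit. Qed.

(** Minimising over all rows of all unimodular matrices, rather than over
    primitive vectors, makes it immediate that the minimum is attained at a
    vector that belongs to a basis. *)
Lemma minimal_corner d (G : 'M[R]_(1 + d)) : posdef G ->
  exists2 U : 'M[int]_(1 + d), U \in unitmx &
    forall V : 'M[int]_(1 + d), V \in unitmx -> forall i,
      int_congr U G 0 0 <= int_congr V G i i.
Proof.
move=> Gp.
pose P (x : 'rV[int]_(1 + d)) :=
  exists2 U, U \in unitmx & exists i, row i U = x.
have P0 : P (row 0 1%:M) by exists 1%:M; rewrite ?unitmx1 //; exists 0.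
have [_ [U Uu [i <-]] le] := posdef_argmin Gp P0.
exists (tperm_mx 0 i *m U); first by rewrite unitmx_mul unitmx_perm.
move=> V Vu j; rewrite /int_congr -!qf_row -!map_row.
have -> : row 0 (tperm_mx 0 i *m U) = row i U.
  by rewrite -xrowE; apply/rowP => l; rewrite !mxE tpermL.
by apply: le; exists V => //; exists j.
Qed.

(** For [d >= 1] this is [(d!)^2 / d]; the recursion that it has to satisfy is
    [transf_const_step]. *)
Definition transf_const (d : nat) : R := (d`! * (d.-1)`!)%:R.

Lemma transf_const_step d : (0 < d)%N ->
  4 / 3 * transf_const d <= transf_const d.+1 /\
  1 + d%:R ^+ 2 / 3 * transf_const d <= transf_const d.+1.
Proof.
case: d => // m _; rewrite /transf_const /= !factS.
have f1 : 1 <= (m`!)%:R :> R by rewrite ler1n fact_gt0.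
set f : R := (m`!)%:R in f1 *.
rewrite !natrM -/f -(natr1 m.+1) -(natr1 m).
have m0 : 0 <= m%:R :> R by [].
move: (m%:R) m0 => x x0.
have ff : 1 <= f ^+ 2 by rewrite expr_ge1.
have y0 : 0 <= x * f ^+ 2 by rewrite mulr_ge0 // sqr_ge0.
have z0 : 0 <= x * (x * f ^+ 2) by rewrite mulr_ge0.
have t0 : 0 <= x * (x * (x * f ^+ 2)) by rewrite mulr_ge0.
split; nra.
Qed.

(** The number [e i] plays the role of [(4/3)^i] times the squared norm of the
    [i]-th Gram--Schmidt vector.  With this scaling, the growth condition on a
    reduced basis turns into monotonicity of [e], and size-reduction preserves
    the upper bound on the diagonal. *)
Definition has_reduced_basis d (G : 'M[R]_d) : Prop :=
  exists U : 'M[int]_d, exists e : 'I_d -> R,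
    [/\ U \in unitmx, forall i, 0 < e i,
      forall i j : 'I_d, (i <= j)%N -> e i <= e j,
      forall i, int_congr U G i i <= e i &
      forall i, invmx (int_congr U G) i i * e i <= transf_const d].

(** Korkine--Zolotarev reduction: the first basis vector has the least possible
    value [g], the form of rank [d] on the quotient (the Schur complement) is
    reduced by induction, and its basis is lifted with coefficients [r] along
    the first vector that are at most 1/2 in absolute value.  Minimality of [g]
    against the lifted vectors gives [g <= 4/3 * e i].  Dually, the last [d]
    dual vectors do not change under lifting, and the first one acquires the
    value of the inverse form at [r], bounded by [qf_le_diag]. *)
Lemma reduction_step d (G : 'M[R]_(1 + d)) :
  (forall H : 'M[R]_d, posdef H -> has_reduced_basis H) ->
  posdef G -> has_reduced_basis G.
Proof.
move=> IH Gp; have [U0 U0u min0] := minimal_corner Gp.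
have [w [g [H [GE g0 Hp]]]] := schur_complement (int_congr_posdef U0u Gp).
have [V [e [Vu e0 emon He Hie]]] := IH _ Hp.
(* Rounding to the nearest integer. *)
pose s : 'cV[int]_d := \col_i Num.floor ((toR V *m w) i 0 + 2^-1).
pose r := toR V *m w - toR s.
pose U1 : 'M[int]_(1 + d) := block_mx 1%:M 0 0 V.
pose S : 'M[int]_(1 + d) := block_mx 1%:M 0 (- s) 1%:M.
pose U := S *m (U1 *m U0).
pose K := int_congr V H.
have Kp : posdef K by apply: int_congr_posdef.
have Ku := posdef_unit Kp.
have U1u : U1 \in unitmx by rewrite unitmxE det_ublock det1 mul1r -unitmxE.
have Su : S \in unitmx by rewrite unitmxE det_lblock !det1 mul1r unitr1.
have Uu : U \in unitmx by rewrite !unitmx_mul Su U1u U0u.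
have UG : int_congr U G = shear r *m diag_block g K *m (shear r)^T.
  rewrite /U !int_congrM GE /int_congr.
  have SE : toR S = shear (- toR s).
    by rewrite map_block_mx !map_mx1 map_mx0 map_mxN.
  have U1E : toR U1 *m shear w = shear (toR V *m w) *m toR U1.
    rewrite map_block_mx !map_mx0 map_mx1 /shear !mulmx_block.
    by rewrite !mulmx1 !mul1mx !mulmx0 !mul0mx !addr0 !add0r.
  have DE : toR U1 *m diag_block g H *m (toR U1)^T = diag_block g K.
    rewrite map_block_mx !map_mx0 map_mx1 /diag_block tr_block_mx !mulmx_block.
    rewrite !trmx0 trmx1.
    by rewrite !mulmx1 !mul1mx !mulmx0 !mul0mx !addr0 !add0r mul0mx.
  have PE : toR S *m (toR U1 *m shear w) = shear r *m toR U1.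
    by rewrite U1E mulmxA SE shearM addrC.
  have -> : shear r *m diag_block g K *m (shear r)^T =
      (shear r *m toR U1) *m diag_block g H *m (shear r *m toR U1)^T.
    by rewrite -DE trmx_mul !mulmxA.
  by rewrite -PE !trmx_mul !mulmxA.
have r2 i : (r i 0) ^+ 2 <= 4^-1.
  have /andP[h1 h2] : -(2^-1) <= r i 0 <= 2^-1.
    rewrite !mxE; set x := \sum_j _.
    have := floor_le (x + 2^-1); have := floorD1_gt (x + 2^-1).
    rewrite rmorphD /=; lra.
  nra.
have diagK i : 0 <= invmx K i i.
  by rewrite -qf_delta posdef_ge0 //; apply: posdef_inv.
pose e' (i : 'I_(1 + d)) :=
  match fintype.split i with inl _ => g | inr j => 4 / 3 * e j end.
have e'l i : e' (lshift d i) = g by rewrite /e' (unsplitK (inl _)).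
have e'r i : e' (rshift 1 i) = 4 / 3 * e i by rewrite /e' (unsplitK (inr _)).
have UGl i : int_congr U G (lshift d i) (lshift d i) = g.
  by rewrite UG shear_congr block_mxEul mxE ord1.
have UGr i : int_congr U G (rshift 1 i) (rshift 1 i) = K i i + g * (r i 0) ^+ 2.
  by rewrite UG shear_congr block_mxEdr !mxE big_ord1 !mxE.
have g00 : int_congr U0 G 0 0 = g.
  have -> : (0 : 'I_(1 + d)) = lshift d (0 : 'I_1) by apply: val_inj.
  by rewrite GE shear_congr block_mxEul mxE.
have gmin i : g <= int_congr U G i i by rewrite -g00; apply: min0.
have ge i : g <= 4 / 3 * e i.
  have := gmin (rshift 1 i); rewrite UGr.
  have := He i; rewrite -/K; have := r2 i; nra.
exists U, e'; split => //.
- move=> i; case: (split_ordP i) => j ->; rewrite ?e'l ?e'r //.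
  by have := e0 j; lra.
- move=> i j; case: (split_ordP i) => i' ->; case: (split_ordP j) => j' ->;
  rewrite ?e'l ?e'r /=.
  + by [].
  + by move=> _; apply: ge.
  + by rewrite ord1 leqn0.
  + by rewrite leq_add2l => /emon; lra.
- move=> i; case: (split_ordP i) => j ->; rewrite ?e'l ?e'r ?UGl ?UGr //.
  have := He j; rewrite -/K; have := r2 j; have := ge j; nra.
move=> i; rewrite UG shear_congr_invmx ?gt_eqF //.
case: (split_ordP i) => j ->; rewrite ?e'l ?e'r ?block_mxEul ?block_mxEdr.
  rewrite [j]ord1 mxE [_%:M 0 0]mxE eqxx mulr1n mulrDl mulVf ?gt_eqF //.
  have -> : (r^T *m invmx K *m r) 0 0 = qf (invmx K) r^T by rewrite /qf trmxK.
  have le : qf (invmx K) r^T * g <= d%:R ^+ 2 / 3 * transf_const d.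
    apply: (@le_trans _ _ (d%:R * (\sum_(i < d) 3^-1 * transf_const d)));
      last first.
      by rewrite sumr_const card_ord -mulr_natl; lra.
    apply: le_trans (ler_wpM2r (ltW g0) (qf_le_diag _ (posdef_inv Kp))) _.
    rewrite -mulrA ler_wpM2l // mulr_suml; apply: ler_sum => l _; rewrite mxE.
    have := Hie l; rewrite -/K; have := diagK l; have := r2 l; have := ge l.
    have := e0 l; move: (invmx K l l) (r l 0 ^+ 2) (sqr_ge0 (r l 0)).
    move=> a b b0 el gl b1 a0 T.
    have h : a * g <= 4 / 3 * transf_const d.
      by apply: (@le_trans _ _ (a * (4 / 3 * e l))); [apply: ler_wpM2l|lra].
    have ag0 : 0 <= a * g by rewrite mulr_ge0 // ltW.
    nra.
  have [d0|d0] := posnP d; last by have := (transf_const_step d0).2; lra.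
  have h : d%:R ^+ 2 / 3 * transf_const d = 0 by rewrite d0 expr0n !mul0r.
  have T1 : transf_const d.+1 = 1 by rewrite d0.
  by lra.
have [d0|d0] := posnP d; first by have := ltn_ord j; rewrite [X in (_ < X)%N]d0.
by have := (transf_const_step d0).1; have := Hie j; rewrite -/K; lra.
Qed.

Theorem reduction d (G : 'M[R]_d) : posdef G -> has_reduced_basis G.
Proof.
elim: d G => [|d IH] G Gp; last exact: (reduction_step IH Gp).
by exists 1%:M, (fun=> 0); split; rewrite ?unitmx1 // => -[].
Qed.

(** * Transference between a lattice and its dual *)

Lemma rowsub_unit_free d m (P : 'M[R]_d) (f : 'I_m -> 'I_d) :
  injective f -> P \in unitmx -> row_free (rowsub f P).
Proof.
move=> finj Pu; apply/row_freeP; exists (invmx P *m (rowsub f 1%:M)^T).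
rewrite mulmxA mul_rowsub_mx mulmxV // mul_rowsub_mx mul1mx.
by apply/matrixP => i j; rewrite !mxE (inj_eq finj) eq_sym.
Qed.

(** The alternative is decided by the [k]-th of the bounds [e]: if it is at most
    1 then so are those before it; otherwise it and all later ones exceed 1. *)
Theorem transference d (G : 'M[R]_d) k : posdef G -> (1 <= k <= d)%N ->
  (exists C : 'M[int]_(k, d), row_free (toR C) /\
     forall i, qf G (row i (toR C)) <= 1) \/
  (exists M : 'M[int]_(d + 1 - k, d), row_free (toR M) /\
     forall i, qf (invmx G) (row i (toR M)) <= transf_const d).
Proof.
move=> Gp /andP[k1 kd].
have [U [e [Uu e0 emon Ge Gie]]] := reduction Gp.
have UR := intmx_unit Uu.
have lk : (k.-1 < d)%N by rewrite prednK.
have [le|lt] := leP (e (Ordinal lk)) 1; [left|right].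
  exists (rowsub (widen_ord kd) U); rewrite map_mxsub; split.
    by apply: rowsub_unit_free => // i j /(congr1 val) /= ?; apply: val_inj.
  move=> i; rewrite row_rowsub qf_row; apply: le_trans (Ge _) _.
  by apply: le_trans le; apply: emon => /=; rewrite -ltnS prednK.
have fP (i : 'I_(d + 1 - k)) : (k.-1 + i < d)%N by have := ltn_ord i; lia.
pose f i := Ordinal (fP i).
have IE : (toR (invmx U))^T \in unitmx.
  by rewrite unitmx_tr intmx_unit // unitmx_inv.
exists (rowsub f (invmx U)^T); rewrite map_mxsub -map_trmx; split.
  apply: rowsub_unit_free => // i j /(congr1 val) /= /addnI ?; exact: val_inj.
move=> i; rewrite row_rowsub qf_row intmx_inv // trmxK.
have Gu := posdef_unit Gp.
have -> : (invmx (toR U))^T *m invmx G *m invmx (toR U) = invmx (int_congr U G).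
  have Cu := posdef_unit (int_congr_posdef Uu Gp).
  rewrite -[LHS](mulmxK Cu) -[RHS]mul1mx; congr (_ *m _).
  rewrite /int_congr !mulmxA mulmxKV // mulmxKV //.
  by rewrite -trmx_mul mulmxV // trmx1.
have := Gie (f i); have : e (Ordinal lk) <= e (f i).
  by apply: emon => /=; rewrite leq_addr.
have : 0 <= invmx (int_congr U G) (f i) (f i).
  by rewrite -qf_delta posdef_ge0 //; apply/posdef_inv/int_congr_posdef.
nra.
Qed.

(** * Integer points of a rational subspace *)

Definition row_tuple k n (M : 'M[R]_(k, n)) : k.-tuple 'rV[R]_n :=
  [tuple row i M | i < k].

Lemma row_tuple_nth k n (M : 'M[R]_(k, n)) (i : 'I_k) :
  (row_tuple M)`_i = row i M.
Proof. by rewrite -tnth_nth tnth_mktuple. Qed.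

Lemma free_row_tuple k n (M : 'M[R]_(k, n)) : free (row_tuple M) = row_free M.
Proof.
rewrite -kermx_eq0; apply/freeP/rowV0P => h.
  move=> u /sub_kermxP uM; apply/rowP => i; rewrite mxE.
  apply: (h (fun i => u 0 i)); rewrite -[RHS]uM mulmx_sum_row.
  by apply: eq_bigr => j _; rewrite row_tuple_nth.
move=> c cM i.
have /rowP/(_ i) : \row_i c i = 0.
  apply: h; apply/sub_kermxP; rewrite mulmx_sum_row -[RHS]cM.
  by apply: eq_bigr => j _; rewrite row_tuple_nth mxE.
by rewrite !mxE.
Qed.

Lemma row_tuple_tnth k n (X : k.-tuple 'rV[R]_n) :
  row_tuple (\matrix_i tnth X i) = X.
Proof. by apply: eq_from_tnth => i; rewrite tnth_mktuple rowK. Qed.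

Lemma span_row_tuple k n (M : 'M[R]_(k, n)) x :
  x \in <<row_tuple M>>%VS <-> exists a, x = a *m M.
Proof.
split=> [/coord_span ->|[a ->]].
  exists (\row_i coord (row_tuple M) i x); rewrite mulmx_sum_row.
  by apply: eq_bigr => i _; rewrite row_tuple_nth mxE.
rewrite mulmx_sum_row; apply: memv_suml => i _; apply: memvZ.
by apply: memv_span; apply/tnthP; exists i; rewrite tnth_mktuple.
Qed.

Lemma indep_int_pointsP n (F : {vspace 'rV[R]_n}) k A :
  indep_int_points F k A <-> exists M : 'M[int]_(k, n), row_free (toR M) /\
    forall i, row i (toR M) \in F /\ A (row i (toR M)).
Proof.
split=> [[X [Xf XA]]|[M [Mf MA]]].
  have h i : exists z : 'rV[int]_n, tnth X i = toR z.
    by have [[_ []]] := XA _ (mem_tnth i X) => z; exists z.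
  have [z zE] := fin_all_exists h.
  have E : toR (\matrix_i z i) = \matrix_i tnth X i.
    by apply/row_matrixP => i; rewrite -map_row !rowK zE.
  exists (\matrix_i z i); rewrite E -free_row_tuple row_tuple_tnth.
  split => // i.
  by rewrite rowK; have [[]] := XA _ (mem_tnth i X).
exists (row_tuple (toR M)); rewrite free_row_tuple; split => // x /tnthP[i ->].
rewrite tnth_mktuple; have [iF iA] := MA i; split => //; split => //.
by exists (row i M); rewrite map_row.
Qed.

Lemma rational_multiple n (x : 'rV[R]_n) : rational_vec x ->
  exists D : int, exists z : 'rV[int]_n, D != 0 /\ D%:~R *: x = toR z.
Proof.
case=> q ->; exists (\prod_i denq (q 0 i)).
exists (\row_i ((\prod_(j | j != i) denq (q 0 j)) * numq (q 0 i))); split.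
  by apply/prodf_neq0 => i _; apply: denq_neq0.
apply/rowP => i; rewrite !mxE -ratr_int -rmorphM /= -[RHS]ratr_int.
congr ratr; rewrite (bigD1 i) //= !rmorphM /= mulrAC mulrC; congr (_ * _).
by rewrite numqE mulrC.
Qed.

(** A Z-basis of the integer points spans [F] over the reals, since a rational
    basis of [F] has integer multiples; by counting it is then a real basis. *)
Lemma lattice_basis n (F : {vspace 'rV[R]_n}) (Bt : (\dim F).-tuple 'rV[R]_n) :
  rational_subspace F -> Z_basis F Bt ->
  exists B : 'M[int]_(\dim F, n),
  [/\ row_free (toR B), forall x, x \in F <-> exists a, x = a *m toR B &
     Bt = row_tuple (toR B)].
Proof.
move=> [X [Xb Xr]] [Bi Bu].
have [z zE] := fin_all_exists (fun i => (Bi i).2).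
pose B := \matrix_i z i.
have BE : Bt = row_tuple (toR B).
  by apply: eq_from_tnth => i; rewrite tnth_mktuple -map_row rowK zE.
have cE x : int_points F x -> exists c, x = toR (c *m B).
  move=> /Bu[c [-> _]]; exists c; rewrite map_mxM mulmx_sum_row.
  apply: eq_bigr => i _; rewrite BE tnth_mktuple mxE.
  by rewrite scaler_int.
have sF : (F <= <<Bt>>)%VS.
  suff: (<<X>> <= <<Bt>>)%VS by rewrite (span_basis Xb).
  apply/span_subvP => x xX.
  have [D [w [D0 wE]]] := rational_multiple (Xr _ xX).
  have Dx : int_points F (D%:~R *: x).
    split; last by exists w.
    by apply: memvZ; rewrite -(span_basis Xb) memv_span.
  have [c cx] := cE _ Dx.
  have D0' : D%:~R != 0 :> R by rewrite intr_eq0.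
  rewrite -[x](scalerK D0') memvZ // cx BE; apply/span_row_tuple.
  by exists (toR c); rewrite map_mxM.
have Bb : basis_of F Bt by rewrite basisEdim sF size_tuple leqnn.
exists B; split => //.
  by rewrite -free_row_tuple -BE (basis_free Bb).
move=> x; have := span_row_tuple (toR B) x.
by rewrite -BE (span_basis Bb).
Qed.

Lemma span_rational n (X : seq 'rV[R]_n) :
  (forall x, x \in X -> rational_vec x) -> rational_subspace <<X>>%VS.
Proof.
elim: X => [_|x X IH h]; first by exists [::]; rewrite span_nil nil_basis.
have [|Y [Yb Yr]] := IH; first by move=> y yX; apply: h; rewrite inE yX orbT.
have [xX|xX] := boolP (x \in <<X>>%VS).
  exists Y; split => //; rewrite span_cons (addv_idPr _) //.
exists (x :: Y); split; last first.
  move=> y; rewrite inE => /orP[/eqP->|/Yr //]; apply: h; exact: mem_head.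
rewrite /basis_of span_cons (span_basis Yb) span_cons eqxx free_cons.
by rewrite (span_basis Yb) xX (basis_free Yb).
Qed.

(** If [M] holds the coordinates of the lattice basis in an orthonormal basis,
    the Gram matrix of the lattice basis is the product of [M] and its
    transpose. *)
Lemma lattice_det n (F : {vspace 'rV[R]_n}) (B : 'M[int]_(\dim F, n))
    (E : (\dim F).-tuple 'rV[R]_n) :
  orthonormal_basis F E -> (forall i, row i (toR B) \in F) ->
  `|\det (\matrix_(i, j) coord E j (tnth (row_tuple (toR B)) i))| ^+ 2 =
  \det (toR B *m (toR B)^T).
Proof.
move=> [Eb Eo] BF; set M := \matrix_(i, j) _.
pose EM := \matrix_i tnth E i.
have BE : toR B = M *m EM.
  apply/row_matrixP => i; rewrite row_mul mulmx_sum_row.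
  rewrite [LHS](coord_basis Eb (BF i)); apply: eq_bigr => j _.
  by rewrite rowK !mxE tnth_mktuple -tnth_nth.
have EE : EM *m EM^T = 1%:M.
  apply/matrixP => i j; rewrite mxE [RHS]mxE -Eo /dot.
  by apply: eq_bigr => l _; rewrite !mxE.
rewrite BE trmx_mul mulmxA -(mulmxA M) EE mulmx1 det_mulmx det_tr.
by rewrite real_normK ?num_real.
Qed.

(** A nonzero rational [z] in [F] orthogonal to [alpha] would give a linear
    relation with rational coefficients [h i] between the coordinates of
    [alpha] in a rational basis [x] of [F].  Eliminating one [x j] with
    [h j != 0] confines [alpha] to the span of the [d - 1] rational vectors
    [x i - (h i / h j) *: x j], against the minimality of [F]. *)
Lemma orthogonal_int_point n (alpha : 'rV[R]_n) (F : {vspace 'rV[R]_n}) z :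
  smallest_rational_subspace alpha F ->
  z \in F -> rational_vec z -> dot z alpha = 0 -> z = 0.
Proof.
move=> [[X [Xb Xr]] aF Fmin] zF [q zq] za.
have sX : size X == \dim F.
  by rewrite -(span_basis Xb) eq_sym; apply: basis_free Xb.
move: Xb Xr; rewrite -[X]/(val (Tuple sX)).
move: (Tuple sX) => {sX}Y Yb Yr; pose x i := tnth Y i.
pose h i := dot (x i) z.
have xE v : v \in F -> v = \sum_i coord Y i v *: x i.
  move=> vF; rewrite [LHS](coord_basis Yb vF).
  by apply: eq_bigr => i _; rewrite -tnth_nth.
have dotx v : v \in F -> dot v z = \sum_i coord Y i v * h i.
  move=> /xE {1}->; rewrite dotE mulmx_suml summxE; apply: eq_bigr => i _.
  by rewrite -scalemxAl mxE -dotE.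
have hq i : exists c, h i = ratr c.
  have [p pE] := Yr _ (mem_tnth i Y).
  exists (\sum_j p 0 j * q 0 j); rewrite rmorph_sum; apply: eq_bigr => j _.
  by rewrite /x pE zq !mxE rmorphM.
have [/forallP h0|] := boolP [forall i, h i == 0].
  have zz : dot z z = 0.
    by rewrite dotx // big1 // => i _; rewrite (eqP (h0 i)) mulr0.
  exact: dot_eq0.
rewrite negb_forall => /existsP[j hj].
pose y i := x i - (h i / h j) *: x j.
pose W := [seq y i | i <- enum (predC1 j)].
have Wr v : v \in W -> rational_vec v.
  move=> /mapP[i _ ->]; have [c cE] := hq i; have [c' c'E] := hq j.
  have [p pE] := Yr _ (mem_tnth i Y); have [p' p'E] := Yr _ (mem_tnth j Y).
  exists (p - (c / c') *: p'); apply/rowP => l.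
  by rewrite /y /x pE p'E cE c'E !mxE rmorphB !rmorphM /= fmorphV.
have aW : alpha \in <<W>>%VS.
  have -> : alpha = \sum_i coord Y i alpha *: y i.
    rewrite (eq_bigr (fun i => coord Y i alpha *: x i -
       ((coord Y i alpha * h i) / h j) *: x j)); last first.
      by move=> i _; rewrite scalerBr scalerA mulrA.
    rewrite sumrB -scaler_suml -mulr_suml -dotx // dotE.
    have -> : alpha *m z^T = (z *m alpha^T)^T by rewrite trmx_mul trmxK.
    by rewrite mxE -dotE za mul0r scale0r subr0 -xE.
  apply: memv_suml => i _; apply: memvZ; have [->|ij] := eqVneq i j.
    by rewrite /y divff // scale1r subrr mem0v.
  by apply/memv_span/map_f; rewrite mem_enum inE.
have := dimvS (Fmin _ (span_rational Wr) aW).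
move/leq_trans => /(_ _ (dim_span W)).
rewrite size_map -cardE cardC1 card_ord.
by rewrite leqNgt ltn_predL (leq_ltn_trans _ (ltn_ord j)).
Qed.

(** * The elongated ellipsoid *)

Lemma coord_le_norm n (x : 'rV[R]_n) i : `|x 0 i| <= `|x|.
Proof.
rewrite [leRHS]mx_normrE.
exact: (le_bigmax _ (fun ij => `|x ij.1 ij.2|) (0, i)).
Qed.

Lemma norm_le_coord n (x : 'rV[R]_n) K :
  0 <= K -> (forall i, `|x 0 i| <= K) -> `|x| <= K.
Proof.
move=> K0 h; rewrite [leLHS]mx_normrE; apply: bigmax_le => // -[i j] _ /=.
by rewrite ord1.
Qed.

Lemma int_norm_ge1 n (x : 'rV[int]_n) : toR x != 0 -> 1 <= `|toR x|.
Proof.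
move=> /eqP xn0; rewrite leNgt; apply/negP => lt; apply: xn0.
apply/rowP => i; have := le_lt_trans (coord_le_norm (toR x) i) lt.
rewrite !mxE -intr_norm -[1]/(1%:~R) ltr_int -[X in _ < X]add0r ltzD1.
by rewrite normr_le0 => /eqP ->.
Qed.

Lemma sqr_coord_le_dot n (x : 'rV[R]_n) i : x 0 i ^+ 2 <= dot x x.
Proof.
rewrite /dot (bigD1 i) //= -expr2 lerDl sumr_ge0 // => j _.
by rewrite -expr2 sqr_ge0.
Qed.

Lemma sqr_coord2_le_dot n (x : 'rV[R]_n) i j : j != i ->
  x 0 i ^+ 2 + x 0 j ^+ 2 <= dot x x.
Proof.
move=> ij; rewrite /dot (bigD1 i) //= (bigD1 j) //= -!expr2 addrA lerDl.
by apply: sumr_ge0 => l _; rewrite -expr2 sqr_ge0.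
Qed.

(** The component of [x] orthogonal to [alpha]. *)
Definition perp n (alpha x : 'rV[R]_n) : 'rV[R]_n :=
  x - (dot x alpha / dot alpha alpha) *: alpha.

Lemma dot_perp n (alpha x : 'rV[R]_n) : alpha != 0 ->
  dot (perp alpha x) (perp alpha x) =
  dot x x - dot x alpha ^+ 2 / dot alpha alpha.
Proof.
move=> /dot_gt0 p; rewrite /perp !(dotBl, dotZl).
rewrite ![dot _ (_ - _)]dotC !(dotBl, dotZl) [dot alpha x]dotC.
by field; rewrite gt_eqF.
Qed.

(** The ellipsoid [elong alpha g kap x <= 1] is a solid of revolution around the
    line of [alpha], with [g] and [kap] setting the transverse and the
    longitudinal size. *)
Definition elong n (alpha : 'rV[R]_n) (g kap : R) (x : 'rV[R]_n) : R :=
  g * dot (perp alpha x) (perp alpha x) + kap * dot x alpha ^+ 2.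

(** [elong] in the coordinates of the rows of [B]; see [qf_elong_gram]. *)
Definition elong_gram d n (alpha : 'rV[R]_n) (g kap : R) (B : 'M[R]_(d, n)) :
    'M[R]_d :=
  g *: (B *m B^T)
  + (kap - g / dot alpha alpha) *: ((B *m alpha^T) *m (B *m alpha^T)^T).

Lemma qf_elong_gram d n (alpha : 'rV[R]_n) g kap (B : 'M[R]_(d, n)) c :
  alpha != 0 -> qf (elong_gram alpha g kap B) c = elong alpha g kap (c *m B).
Proof.
move=> a0; rewrite /elong dot_perp // /qf /elong_gram mulmxDr mulmxDl.
rewrite -!scalemxAr -!scalemxAl [LHS]mxE mxE [X in _ + X]mxE.
have -> : (c *m (B *m B^T) *m c^T) 0 0 = dot (c *m B) (c *m B).
  by rewrite dotE trmx_mul !mulmxA.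
have -> : (c *m (B *m alpha^T *m (B *m alpha^T)^T) *m c^T) 0 0 =
    dot (c *m B) alpha ^+ 2.
  rewrite dotE !mulmxA -[_ *m c^T]mulmxA -trmx_mul !mulmxA.
  by rewrite mxE big_ord1 [_^T _ _]mxE expr2.
ring.
Qed.

Lemma elong_gram_posdef d n (alpha : 'rV[R]_n) g kap (B : 'M[R]_(d, n)) :
  alpha != 0 -> 0 < g -> 0 < kap -> row_free B ->
  posdef (elong_gram alpha g kap B).
Proof.
move=> a0 g0 k0 Bf; split.
  by rewrite /elong_gram linearD /= !linearZ /= !trmx_mul !trmxK.
move=> c c0; rewrite qf_elong_gram // /elong; set x := c *m B.
have x0 : x != 0.
  by apply: contra_neq c0 => xE; apply: (row_free_inj Bf); rewrite mul0mx.
have p := dot_ge0 (perp alpha x); have s := sqr_ge0 (dot x alpha).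
have [xa|xa] := eqVneq (dot x alpha) 0.
  rewrite dot_perp // xa expr0n mul0r subr0 mulr0 addr0.
  by rewrite mulr_gt0 // dot_gt0.
rewrite ltr_wpDl // ?mulr_ge0 ?(ltW g0) // mulr_gt0 //.
by rewrite lt_def sqrf_eq0 xa.
Qed.

(** Replacing [x] by its transverse part [w] does not change the vector to be
    bounded.  Its [i]-th coordinate is a combination of the two distinct
    coordinates [i0] and [i] of [w] only, with coefficients at most [|alpha|]
    in absolute value, so that its square is at most
    [2 * |alpha| ^+ 2 * dot w w], independently of the dimension [n]. *)
Lemma elong_le1_close n (alpha : 'rV[R]_n) i0 Q kap x :
  alpha != 0 -> `|alpha| = `|alpha 0 i0| -> 0 < Q -> 0 <= kap ->
  elong alpha (2 * `|alpha| ^+ 2 * Q ^+ 2) kap x <= 1 ->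
  `|x 0 i0 *: alpha - alpha 0 i0 *: x| <= Q^-1.
Proof.
move=> a0 an Q0 k0 le; set w := perp alpha x.
have n0 : 0 < `|alpha| by rewrite normr_gt0.
have W : 2 * `|alpha| ^+ 2 * dot w w <= Q^-1 ^+ 2.
  rewrite exprVn -[leRHS]mul1r ler_pdivlMr ?exprn_gt0 //.
  apply: le_trans le; rewrite /elong -/w mulrAC lerDl mulr_ge0 //.
  exact: sqr_ge0.
apply: norm_le_coord => [|i]; first by rewrite invr_ge0 ltW.
have -> : (x 0 i0 *: alpha - alpha 0 i0 *: x) 0 i =
    w 0 i0 * alpha 0 i - alpha 0 i0 * w 0 i.
  by rewrite /w /perp !mxE; ring.
rewrite -(ler_pXn2r (n := 2)) ?nnegrE ?invr_ge0 ?(ltW Q0) //.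
apply: le_trans W; rewrite real_normK ?num_real //.
have a2 : alpha 0 i0 ^+ 2 = `|alpha| ^+ 2 by rewrite an real_normK ?num_real.
have b2 : alpha 0 i ^+ 2 <= `|alpha| ^+ 2.
  rewrite -[alpha 0 i ^+ 2]real_normK ?num_real //.
  by rewrite ler_pXn2r ?nnegrE // coord_le_norm.
have [->|ii] := eqVneq i i0.
  by rewrite [X in _ - X]mulrC subrr expr0n /= !mulr_ge0 ?dot_ge0 ?sqr_ge0.
have := sqr_coord2_le_dot w ii.
move: (w 0 i0) (w 0 i) (dot w w) => p q W h.
apply: (@le_trans _ _
  (2 * (p ^+ 2 * alpha 0 i ^+ 2 + alpha 0 i0 ^+ 2 * q ^+ 2))).
  have := sqr_ge0 (p * alpha 0 i + alpha 0 i0 * q); nra.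
rewrite a2; have := sqr_ge0 p; have := sqr_ge0 q; nra.
Qed.

(** A coordinate of [x] is at most [s + q], where [s] is the sup norm of the
    component along [alpha] and [q] a coordinate of the transverse component.
    As [s ^+ 2 / k1 + g * q ^+ 2 <= 1], the Cauchy--Schwarz inequality gives
    [(s + q) ^+ 2 <= k1 + g^-1].  Without transverse component only [k1]
    remains. *)
Lemma elong_le1_norm n (alpha : 'rV[R]_n) g k1 K x :
  alpha != 0 -> 0 < g -> 0 < k1 -> 0 <= K ->
  k1 + g^-1 <= K ^+ 2 \/ (perp alpha x = 0 /\ k1 <= K ^+ 2) ->
  elong alpha g (`|alpha| ^+ 2 / (dot alpha alpha ^+ 2 * k1)) x <= 1 ->
  `|x| <= K.
Proof.
move=> a0 g0 k10 K0 hyp; rewrite /elong; set w := perp alpha x.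
have N0 := dot_gt0 a0.
pose s := `|alpha| * `|dot x alpha / dot alpha alpha|.
have s0 : 0 <= s by rewrite mulr_ge0.
have -> : `|alpha| ^+ 2 / (dot alpha alpha ^+ 2 * k1) * dot x alpha ^+ 2 =
    s ^+ 2 / k1.
  rewrite /s exprMn real_normK ?num_real //; field.
  by rewrite !gt_eqF.
move=> le; apply: norm_le_coord => // i.
have xi : `|x 0 i| <= s + `|w 0 i|.
  have -> : x 0 i = (dot x alpha / dot alpha alpha) * alpha 0 i + w 0 i.
    by rewrite /w /perp !mxE; ring.
  apply: le_trans (ler_normD _ _) _; rewrite lerD2r normrM mulrC.
  by apply: ler_wpM2r => //; apply: coord_le_norm.
apply: (le_trans xi); rewrite -(ler_pXn2r (n := 2)) ?nnegrE ?addr_ge0 //.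
case: hyp => [h|[w0 h]]; last first.
  move: le; rewrite /w w0 dotE mul0mx mxE mulr0 add0r mxE normr0 addr0.
  by rewrite ler_pdivrMr // mul1r => le; apply: le_trans h.
apply: le_trans h; have := sqr_coord_le_dot w i.
rewrite -[w 0 i ^+ 2]real_normK ?num_real //.
move: (`|w 0 i|) (dot w w) le => q W le qW.
have le' : s ^+ 2 / k1 + g * q ^+ 2 <= 1.
  by apply: le_trans le; rewrite addrC lerD2r ler_wpM2l // ltW.
rewrite -subr_ge0; apply: (@le_trans _ _
  ((s ^+ 2 / k1 + g * q ^+ 2) * (k1 + g^-1) - (s + q) ^+ 2)); last first.
  rewrite lerD2r -[leRHS]mul1r ler_wpM2r // addr_ge0 ?invr_ge0 ?ltW //.
have -> : (s ^+ 2 / k1 + g * q ^+ 2) * (k1 + g^-1) - (s + q) ^+ 2 =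
    (s - g * k1 * q) ^+ 2 / (g * k1).
  by field; rewrite !gt_eqF.
by rewrite divr_ge0 ?sqr_ge0 // mulr_ge0 // ltW.
Qed.

(** * The two directions of the duality *)

Lemma gram_unit d n (B : 'M[R]_(d, n)) : row_free B -> B *m B^T \in unitmx.
Proof.
move=> Bf; rewrite -row_free_unit -kermx_eq0; apply/negPn/negP => K0.
have /rowV0Pn[x /sub_kermxP xA /negP[]] := K0.
apply/eqP/(row_free_inj Bf); rewrite mul0mx; apply: dot_eq0.
by rewrite dotE trmx_mul !mulmxA -(mulmxA x) xA mul0mx mxE.
Qed.

(** Otherwise the row spaces of [C] and of [D], moved by the invertible Gram
    matrix, would be orthogonal in dimension [d], hence of total rank at most
    [d]. *)
Lemma not_all_orthogonal d k l n (B : 'M[R]_(d, n)) (C : 'M[R]_(k, d))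
    (D : 'M[R]_(l, d)) : row_free B -> row_free (C *m B) -> row_free (D *m B) ->
  (d < k + l)%N -> exists i j, dot (row i (C *m B)) (row j (D *m B)) != 0.
Proof.
move=> Bf; rewrite /row_free !(mxrankMfree _ Bf) => /eqP Cf /eqP Df kl.
apply: contrapT => nex; move: kl; rewrite ltnNge => /negP[].
have Af : row_free (B *m B^T) by rewrite row_free_unit gram_unit.
rewrite -Cf -Df -(mxrankMfree C Af) -(mxrank_tr D); apply: mulmx0_rank_max.
apply/matrixP => i j; rewrite [RHS]mxE; apply: contrapT => /eqP ne0.
apply: nex; exists i, j; apply: contra_neq ne0 => <-.
rewrite dotE !row_mul trmx_mul !mulmxA -!row_mul tr_row [LHS]mxE 2![RHS]mxE.
by apply: eq_bigr => s _; rewrite [col _ _ _ _]mxE.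
Qed.

Lemma rows_coord n (F : {vspace 'rV[R]_n}) d (B : 'M[R]_(d, n)) k
    (M : 'M[R]_(k, n)) :
  (forall x, x \in F <-> exists a, x = a *m B) -> (forall i, row i M \in F) ->
  exists C, M = C *m B.
Proof.
move=> FB MF; have [c cE] := fin_all_exists (fun i => (FB _).1 (MF i)).
exists (\matrix_i c i); apply/row_matrixP => i; by rewrite row_mul rowK cE.
Qed.

Lemma int_dot n (x y : 'rV[int]_n) :
  dot (toR x) (toR y) = ((x *m y^T) 0 0)%:~R.
Proof. by rewrite dotE map_trmx -map_mxM mxE. Qed.

Lemma norm_dot_le n (x y : 'rV[R]_n) : `|dot x y| <= n%:R * (`|x| * `|y|).
Proof.
apply: le_trans (ler_norm_sum _ _ _) _.
rewrite mulr_natl -[n in _ *+ n]card_ord -sumr_const; apply: ler_sum => i _.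
by rewrite normrM ler_pM // coord_le_norm.
Qed.

(** Finitely many integer points have norm at most [c], and at the nonzero ones
    in [F] the product with [alpha] does not vanish. *)
Lemma int_points_dot_bounded_below n (alpha : 'rV[R]_n)
    (F : {vspace 'rV[R]_n}) (c : R) :
  smallest_rational_subspace alpha F ->
  exists2 eps : R, 0 < eps & forall z, int_points F z -> z != 0 -> `|z| <= c ->
    eps <= `|dot z alpha|.
Proof.
move=> hF.
pose P x := [/\ toR x \in F, toR x != 0 & `|toR x : 'rV[R]_n| <= c].
have [[x0 P0]|none] := pselect (exists x0, P x0); last first.
  by exists 1 => // z' [zF [z E]] z0 zc; subst z'; case: none; exists z.
have [|x [xF xn0 xc] xmin] := @bounded_argmin _ P
    (fun x => `|dot (toR x) alpha|) (Num.bound c) x0 P0.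
  move=> x [_ _ xc] _ i; have := le_trans (coord_le_norm (toR x) i) xc.
  have c0 := le_trans (normr_ge0 _) xc.
  rewrite mxE => xi; rewrite -(ler_int R) intr_norm.
  apply: le_trans xi _; exact/ltW/(archi_boundP c0).
exists `|dot (toR x) alpha|; last first.
  move=> z' [zF [z E]] z0 zc; subst z'; exact: xmin.
rewrite normr_gt0; apply: contra_neq xn0 => /(orthogonal_int_point hF xF).
apply; exists (map_mx intr x); apply/rowP => j; by rewrite !mxE ratr_int.
Qed.

Lemma dim1_perp n (F : {vspace 'rV[R]_n}) (alpha x : 'rV[R]_n) :
  alpha != 0 -> alpha \in F -> (\dim F <= 1)%N -> x \in F -> perp alpha x = 0.
Proof.
move=> a0 aF F1 xF.
have : x \in <[alpha]>%VS.
  suff -> : <[alpha]>%VS = F by [].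
  by apply/eqP; rewrite eqEdim -memvE aF dim_vline a0.
move=> /vlineP[c ->]; rewrite /perp dotZl mulfK ?subrr //.
by rewrite gt_eqF // dot_gt0.
Qed.

(** The number [k1] is the square of the longitudinal half-axis.  The second
    condition makes the constant of the transference principle sufficient, the
    third one makes the ellipsoid fit into the box; for [d = 1] both force
    [k1 = K ^+ 2]. *)
Lemma axis_length d (K g : R) : (0 < d)%N -> 2^-1 <= K -> 32 <= g ->
  exists k1 : R, [/\ 0 < k1, K ^+ 2 <= d%:R * k1 &
    if d == 1%N then k1 <= K ^+ 2 else k1 + g^-1 <= K ^+ 2].
Proof.
move=> d0 hK hg; have K2 : 4^-1 <= K ^+ 2 by nra.
have gi : g^-1 <= 32^-1 by rewrite lef_pV2 // posrE; lra.
exists (if d == 1%N then K ^+ 2 else K ^+ 2 - g^-1).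
case: eqP => [->|d1]; first by split => //; lra.
have d2 : 2 <= d%:R :> R by rewrite (ler_nat R 2); lia.
have : 0 <= g^-1 by rewrite invr_ge0; lra.
split; nra.
Qed.

Lemma mul_transf_const d : (0 < d)%N -> d%:R * transf_const d = d`!%:R ^+ 2.
Proof.
by case: d => // m _; rewrite /transf_const -natrM mulnCA -factS -natrX -mulnn.
Qed.

(** Transference for the elongated form in the coordinates of the lattice
    basis.  A short dual vector [m] yields the integer point
    [z = m *m \adj A *m B], where [A] is the Gram matrix, because then
    [dot z (c *m B) = \det A * dot m c] for all [c].  The Cauchy--Schwarz
    inequality applied to [c *m B = alpha] bounds [dot z alpha], and applied to
    [c *m B = z] it bounds [dot z z]. *)
Lemma primal_or_dual_points n (alpha : 'rV[R]_n) i0 (F : {vspace 'rV[R]_n})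
    (B : 'M[int]_(\dim F, n)) k K Q :
  alpha != 0 -> `|alpha| = `|alpha 0 i0| -> alpha \in F ->
  row_free (toR B) -> (forall x, x \in F <-> exists a, x = a *m toR B) ->
  0 <= \det (toR B *m (toR B)^T) ->
  (1 <= k <= \dim F)%N -> 2^-1 <= K -> 0 < Q -> 4 <= `|alpha| * Q ->
  let c3 := \det (toR B *m (toR B)^T) * (\dim F)`!%:R * `|alpha| in
  indep_int_points F k [set x : 'rV[R]_n | `|x| <= K /\
               `|x 0 i0 *: alpha - alpha 0 i0 *: x| <= Q^-1]%classic \/
  indep_int_points F (\dim F + 1 - k)
      [set x : 'rV[R]_n | `|x| <= 2 * c3 * Q /\
                          `|dot x alpha| <= c3 / K]%classic.
Proof.
move=> a0 an aF Bf FB Dpos hk hK Q0 aQ c3.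
set d := \dim F in B Bf FB Dpos hk c3 *.
have d0 : (0 < d)%N by case/andP: hk => k1 /(leq_trans k1).
have n0 : 0 < `|alpha| by rewrite normr_gt0.
have N0 := dot_gt0 a0; set N2 := dot alpha alpha in N0.
have aN : `|alpha| ^+ 2 <= N2.
  by rewrite an real_normK ?num_real // sqr_coord_le_dot.
pose g : R := 2 * `|alpha| ^+ 2 * Q ^+ 2.
have hg : 32 <= g by rewrite /g -mulrA -exprMn; nra.
have g0 : 0 < g by lra.
have [k1 [k10 Kk1 hk1]] := axis_length d0 hK hg.
(* Squared half-axis [k1] along [alpha], measured in the sup norm. *)
pose kap : R := `|alpha| ^+ 2 / (N2 ^+ 2 * k1).
have kap0 : 0 < kap by rewrite divr_gt0 ?mulr_gt0 ?exprn_gt0.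
have row_in m (C : 'M[R]_(m, d)) i : row i (C *m toR B) \in F.
  by apply/FB; exists (row i C); rewrite row_mul.
pose G := elong_gram alpha g kap (toR B).
have Gp : posdef G by apply: elong_gram_posdef.
have [[C [Cf Cq]]|[M [Mf Mq]]] := transference Gp hk; [left|right].
  apply/indep_int_pointsP; exists (C *m B); rewrite map_mxM; split.
    by rewrite /row_free (mxrankMfree _ Bf).
  move=> i; split => //=; set x := row i _.
  have xq : elong alpha g kap x <= 1.
    by rewrite /x row_mul -qf_elong_gram.
  split; last by apply: elong_le1_close (ltW kap0) xq.
  apply: (elong_le1_norm a0 g0 k10 _ _ xq); first by lra.
  case: eqP hk1 => d1 hk1; [right|left] => //; split => //.
  by apply: (dim1_perp a0 aF) (row_in _ _ _); rewrite -/d d1.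
pose A := toR B *m (toR B)^T; have Au : A \in unitmx by apply: gram_unit.
pose D := \det A.
have adjE : toR (\adj (B *m B^T)) = \adj A.
  by rewrite map_mx_adj map_mxM -map_trmx.
have D0 : D != 0 by rewrite -unitfE -unitmxE.
have adjf : row_free (\adj A).
  by apply/row_freeP; exists (D^-1 *: A); rewrite -scalemxAr mul_adj_mx
    scale_scalar_mx mulVf.
apply/indep_int_pointsP; exists (M *m \adj (B *m B^T) *m B).
rewrite 2!map_mxM adjE; split.
  by rewrite /row_free (mxrankMfree _ Bf) (mxrankMfree _ adjf).
move=> i; split => //=; set z := row i _.
pose m := row i (toR M).
have zE : z = m *m \adj A *m toR B by rewrite /z !row_mul.
have dotz c : dot z (c *m toR B) = D * dot m c.
  rewrite dotE zE trmx_mul !mulmxA -(mulmxA _ (toR B)) -(mulmxA m).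
  by rewrite mul_adj_mx mul_mx_scalar -scalemxAl mxE -dotE.
have CS c : (dot z (c *m toR B)) ^+ 2 <=
    D ^+ 2 * (elong alpha g kap (c *m toR B) * transf_const d).
  rewrite dotz exprMn ler_wpM2l ?sqr_ge0 // dotC.
  apply: le_trans (dual_cauchy_schwarz _ _ Gp) _; rewrite qf_elong_gram //.
  apply: ler_wpM2l (Mq i); rewrite -qf_elong_gram //; exact: posdef_ge0.
have D2 : 0 <= D ^+ 2 by apply: sqr_ge0.
have T0 : 0 <= transf_const d by [].
have Td := mul_transf_const d0.
have f0 : 0 <= d`!%:R :> R by [].
set T := transf_const d in CS T0 Td; set f := d`!%:R in Td f0.
have d0' : 0 < d%:R :> R by rewrite ltr0n.
have TK : T * K ^+ 2 <= f ^+ 2 * k1.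
  by rewrite -Td; have := ler_wpM2l T0 Kk1; lra.
have K0 : 0 < K by lra.
have c30 : 0 <= c3 by rewrite !mulr_ge0.
have Tk1 : T / k1 <= f ^+ 2 / K ^+ 2.
  by rewrite ler_pdivrMr // mulrAC ler_pdivlMr ?exprn_gt0.
have c3E : c3 = D * f * `|alpha| by [].
split.
  have zz : dot z z <= (2 * c3 * Q) ^+ 2.
    have zp := dot_ge0 (perp alpha z); rewrite dot_perp // -/N2 in zp.
    have za0 : 0 <= dot z alpha ^+ 2 / N2 by rewrite divr_ge0 ?sqr_ge0 ?ltW.
    have ez : elong alpha g kap z <= (g + k1^-1) * dot z z.
      rewrite mulrDl /elong dot_perp // -/N2 lerD //.
        by rewrite ler_wpM2l ?(ltW g0) // lerBlDr lerDl.
      have -> : kap * dot z alpha ^+ 2 =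
          k1^-1 * (dot z alpha ^+ 2 / N2 * (`|alpha| ^+ 2 / N2)).
        by rewrite /kap; field; rewrite !gt_eqF.
      rewrite ler_wpM2l ?invr_ge0 ?(ltW k10) //.
      have h1 : `|alpha| ^+ 2 / N2 <= 1 by rewrite ler_pdivrMr // mul1r.
      nra.
    have := CS (m *m \adj A); rewrite -zE => zCS.
    have [->|z0] := eqVneq (dot z z) 0; first exact: sqr_ge0.
    have zpos : 0 < dot z z by rewrite lt_def z0 dot_ge0.
    have zz : dot z z <= D ^+ 2 * (T * (g + k1^-1)).
      rewrite -(ler_pM2r zpos) -expr2; apply: (le_trans zCS).
      rewrite -(mulrA (D ^+ 2)); apply: ler_wpM2l => //; rewrite [leLHS]mulrC.
      by rewrite -(mulrA T); apply: ler_wpM2l.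
    apply: (le_trans zz).
    have -> : (2 * c3 * Q) ^+ 2 = D ^+ 2 * (4 * f ^+ 2 * (`|alpha| * Q) ^+ 2).
      by rewrite c3E; ring.
    rewrite ler_wpM2l // mulrDr.
    have gE : g = 2 * (`|alpha| * Q) ^+ 2 by rewrite /g; ring.
    have aQ2 : 16 <= (`|alpha| * Q) ^+ 2 by nra.
    have Tf : T <= f ^+ 2.
      by rewrite -Td -[leLHS]mul1r ler_wpM2r // ler1n.
    have Kf : f ^+ 2 / K ^+ 2 <= 4 * f ^+ 2.
      rewrite ler_pdivrMr ?exprn_gt0 //.
      have K2 : 4^-1 <= K ^+ 2 by nra.
      have := sqr_ge0 f; nra.
    have := sqr_ge0 f; rewrite gE; move: Tk1 Kf Tf aQ2.
    move: (T / k1) (f ^+ 2 / K ^+ 2) ((`|alpha| * Q) ^+ 2) (f ^+ 2).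
    move=> u v q w; nra.
  apply: norm_le_coord => [|j]; first by rewrite !mulr_ge0 // ltW.
  rewrite -(ler_pXn2r (n := 2)) ?nnegrE ?mulr_ge0 ?(ltW Q0) //.
  rewrite real_normK ?num_real //; apply: le_trans zz.
  exact: sqr_coord_le_dot.
have [a aE] := (FB _).1 aF.
rewrite -(ler_pXn2r (n := 2)) ?nnegrE ?divr_ge0 ?(ltW K0) //.
rewrite real_normK ?num_real // {1}aE; apply: le_trans (CS _) _; rewrite -aE.
have -> : elong alpha g kap alpha = `|alpha| ^+ 2 / k1.
  rewrite /elong dot_perp // -/N2 /kap; field.
  by rewrite !gt_eqF.
have -> : (c3 / K) ^+ 2 = D ^+ 2 * (`|alpha| ^+ 2 * (f ^+ 2 / K ^+ 2)).
  by rewrite c3E; field; rewrite gt_eqF.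
by rewrite ler_wpM2l // mulrAC -mulrA ler_wpM2l ?sqr_ge0.
Qed.

(** The scalar product of the two families takes a nonzero integer value at some
    pair [x], [y]; the identity
    [alpha_0 (x . y) = x_0 (y . alpha) - (x_0 alpha - alpha_0 x) . y] then
    bounds [|alpha|]. *)
Lemma primal_dual_product n (alpha : 'rV[R]_n) i0 (F : {vspace 'rV[R]_n}) d
    (B : 'M[R]_(d, n)) k l Q q K K' :
  `|alpha| = `|alpha 0 i0| ->
  row_free B -> (forall x, x \in F <-> exists a, x = a *m B) ->
  (d < k + l)%N -> 0 < Q -> 0 < K' -> 0 <= q ->
  indep_int_points F k [set x : 'rV[R]_n | `|x| <= K /\
               `|x 0 i0 *: alpha - alpha 0 i0 *: x| <= Q^-1]%classic ->
  indep_int_points F l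
      [set x : 'rV[R]_n | `|x| <= q /\ `|dot x alpha| <= K'^-1]%classic ->
  `|alpha| <= K / K' + n%:R * (q / Q).
Proof.
move=> an Bf FB kl Q0 K'0 q0 /indep_int_pointsP[X [Xf XA]].
move=> /indep_int_pointsP[Y [Yf YA]].
have [C CE] := rows_coord FB (fun i => (XA i).1).
have [D DE] := rows_coord FB (fun i => (YA i).1).
have := not_all_orthogonal (C := C) (D := D) Bf.
rewrite -CE -DE => /(_ Xf Yf kl)[i [j]].
set x := row i (toR X); set y := row j (toR Y) => xy0.
have [_ [/= xK xQ]] := XA i; have [_ [/= yq yK]] := YA j.
rewrite -/x -/y in xK xQ yq yK.
have xy1 : 1 <= `|dot x y|.
  move: xy0; rewrite /x /y -!map_row int_dot -intr_norm intr_eq0.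
  by rewrite -[1]/(1%:~R) ler_int -gtz0_ge1 normr_gt0.
set e := x 0 i0 *: alpha - alpha 0 i0 *: x in xQ.
have E : alpha 0 i0 * dot x y = x 0 i0 * dot y alpha - dot e y.
  by rewrite /e dotBl !dotZl [dot alpha y]dotC; ring.
have : `|alpha| <= `|alpha 0 i0 * dot x y|.
  by rewrite normrM -an -[leLHS]mulr1 ler_wpM2l.
move/le_trans; apply; rewrite E; apply: le_trans (ler_normB _ _) _.
apply: lerD.
  rewrite normrM ler_pM //; exact: le_trans (coord_le_norm _ _) xK.
apply: le_trans (norm_dot_le _ _) _; rewrite ler_wpM2l // mulrC.
by rewrite ler_pM.
Qed.

Lemma row_free_row_neq0 k n (M : 'M[R]_(k, n)) i : row_free M -> row i M != 0.
Proof.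
move=> Mf; apply/eqP => z0; have /rowP/(_ i)/eqP : delta_mx 0 i = 0 :> 'rV[R]_k.
  by apply: (row_free_inj Mf); rewrite /= -rowE z0 mul0mx.
by rewrite !mxE !eqxx oner_eq0.
Qed.

End Transference.

Theorem theorem2p1 (R : realType) (n : nat) (hn : (2 <= n)%N)
    (i0 : 'I_n) (hi0 : nat_of_ord i0 = 0%N)
    (alpha : 'rV[R]_n) (alpha_neq0 : alpha != 0)
    (alpha_norm : `|alpha| = `|alpha 0 i0|)
    (F : {vspace 'rV[R]_n}) (hF : smallest_rational_subspace alpha F)
    (detL : R) (hdetL : is_lattice_det F detL)
    (k : nat) (hk : (1 <= k <= \dim F)%N)
    (C : nat) (hC : is_Cprime F (\dim F + 1 - k) C)
    (Q : R) :
  let d := \dim F in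
  let Q0 := Num.max 1 (n.+2%:R * C%:R * `|alpha|^-1) in
  let c1 := n.+1%:R^-1 * `|alpha| in
  let c2 := n.+2%:R^-1 * `|alpha| in
  let c3 := detL ^+ 2 * (d`!)%:R * `|alpha| in
  let c4 := 2 * c3 in
  Q0 <= Q ->
  c1 * Psi' alpha F (d + 1 - k) (c2 * Q) <= Psi alpha i0 F k Q
    <= c3 * Psi' alpha F (d + 1 - k) (c4 * Q).
Proof.
move=> d Q0 c1 c2 c3 c4; rewrite ge_max => /andP[Q1 QC].
have [C1 _ _] := hC; have [Frat aF _] := hF.
have n0 : 0 < `|alpha| by rewrite normr_gt0.
have Qpos : 0 < Q by lra.
have aQ : 4 <= `|alpha| * Q.
  move: QC; rewrite ler_pdivrMr // [leRHS]mulrC => QC; apply: le_trans QC.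
  rewrite -natrM (ler_nat R 4); clear -hn C1; nia.
have [Bt [E [Bz Eo detLE]]] := hdetL.
have [B [Bf FB BE]] := lattice_basis Frat Bz.
have Brow i : row i (map_mx (intr : int -> R) B) \in F.
  by apply/FB; exists (delta_mx 0 i); rewrite -rowE.
have detE := lattice_det Eo Brow; rewrite -BE -detLE in detE.
move: @c3 @c4; rewrite detE => c3 c4.
have detpos : 0 <= \det (map_mx (intr : int -> R) B *m
    (map_mx (intr : int -> R) B)^T) by rewrite -detE sqr_ge0.
have det0 : \det (map_mx (intr : int -> R) B *m
    (map_mx (intr : int -> R) B)^T) != 0.
  by rewrite -unitfE -unitmxE gram_unit.
have c30 : 0 < c3.
  by rewrite !mulr_gt0 ?ltr0n ?fact_gt0 // lt_def det0.
have c40 : 0 <= c4 * Q by rewrite !mulr_ge0 // ltW.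
have [/andP[k1 kd]] := (hk).
rewrite /Psi /Psi'; set S := (X in inf X).
set S' := fun q : R => [set K : R | 0 < K /\ indep_int_points F (d + 1 - k)
    [set x : 'rV[R]_n | `|x| <= q /\ `|dot x alpha| <= K^-1]]%classic.
rewrite -!/(S' _).
have SS K : 2^-1 <= K -> S K \/ S' (c4 * Q) (K / c3).
  move=> hK; have K0 : 0 < K by lra.
  have [h|h] := primal_or_dual_points alpha_neq0 alpha_norm aF Bf FB detpos
    hk hK Qpos aQ.
    by left; split.
  by right; split; [rewrite divr_gt0|rewrite invf_div].
have [eps eps0 heps] := int_points_dot_bounded_below (c4 * Q) hF.
have l0 : (0 < d + 1 - k)%N by rewrite /d; clear -hk; lia.
have S'b K' : S' (c4 * Q) K' -> K' <= eps^-1.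
  move=> [K'0 /indep_int_pointsP[M [Mf MA]]].
  have [zF [/= zq zK]] := MA (Ordinal l0); set z := row _ _ in zF zq zK.
  rewrite -[K']invrK lef_pV2 ?posrE ?invr_gt0 //; apply: le_trans zK.
  apply: heps => //.
    by split => //; exists (row (Ordinal l0) M); rewrite map_row.
  exact: row_free_row_neq0.
have Sge1 K : S K -> 1 <= K.
  move=> [K0 /indep_int_pointsP[M [Mf MA]]].
  have [xF [/= xK _]] := MA (Ordinal k1); apply: le_trans xK.
  rewrite -map_row; apply: int_norm_ge1; rewrite map_row.
  exact: row_free_row_neq0.
have S0 : (S !=set0)%classic.
  (* Chosen so that [K / c3] exceeds the bound [eps^-1] of [S'b]. *)
  pose K := 1 + c3 / eps.
  have cep : 0 < c3 / eps by rewrite divr_gt0.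
  have [|SK|/S'b] := SS K; [by rewrite /K; lra|by exists K|].
  by rewrite ler_pdivrMr // mulrC /K; lra.
have infge1 : 1 <= inf S by apply: lb_le_inf.
apply/andP; split.
  have n1 : 0 < n.+1%:R :> R by rewrite ltr0n.
  have c10 : 0 < c1 by rewrite mulr_gt0 ?invr_gt0.
  have [[K'0 hK'0]|none] := pselect (S' (c2 * Q) !=set0)%classic; last first.
    have -> : S' (c2 * Q) = set0.
      by apply/seteqP; split => // x Sx; case: none; exists x.
    by rewrite sup0 mulr0; lra.
  rewrite mulrC -ler_pdivlMr //; apply: ge_sup; first by exists K'0.
  move=> K' [K'pos hK']; rewrite ler_pdivlMr //.
  apply: lb_le_inf => // K [K0 hK].
  have q0 : 0 <= c2 * Q by rewrite !mulr_ge0 ?invr_ge0 // ltW.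
  have kl : (d < k + (d + 1 - k))%N by rewrite /d; clear -hk; lia.
  have := primal_dual_product alpha_norm Bf FB kl Qpos K'pos q0 hK hK'.
  rewrite /c2 mulfK ?gt_eqF // => h.
  rewrite mulrC -ler_pdivlMr // /c1.
  apply: (@le_trans _ _ (2 * c2)); last first.
    have aE : `|alpha| = (n%:R + 2) * c2.
      by rewrite /c2 mulrA -natrD addn2 divff ?mul1r // pnatr_eq0.
    by move: h; rewrite -/c2 aE mulrDl [leRHS]addrC lerD2l.
  rewrite /c2 mulrA ler_wpM2r ?(ltW n0) // ler_pdivlMr ?ltr0n //.
  rewrite mulrC ler_pdivrMr // -natrM ler_nat; clear; lia.
rewrite leNgt; apply/negP => lt.
(* [K] is taken strictly between [c3 * Psi'] and [Psi], yet at least 1/2. *)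
pose m := Num.max (c3 * sup (S' (c4 * Q))) 2^-1.
have mlt : m < inf S by rewrite /m gt_max lt /=; lra.
pose K := (m + inf S) / 2.
have Kinf : K < inf S by rewrite /K; lra.
have mK : m < K by rewrite /K; lra.
have K2 : 2^-1 <= K by apply: le_trans (ltW mK); rewrite /m le_max lexx orbT.
have [SK|S'K] := SS _ K2.
  have : inf S <= K by apply: ge_inf => //; exists 1.
  by rewrite leNgt Kinf.
have : K / c3 <= sup (S' (c4 * Q)).
  by apply: ub_le_sup => //; exists eps^-1.
rewrite ler_pdivrMr // mulrC => le.
have : K <= m by rewrite /m le_max le.
by rewrite leNgt mK.
Qed.
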